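(* Let $K_2$ be the graph consisting of two vertices and a single edge. Then $h(K_2)=1$, but $h_Q(\mathbf{B}_{K_2})\le\frac12$.
   Context: For a $d$-regular graph $G=([n],E)$, the edge expansion is $h(G)=\min_{W\subseteq[n],\,1\le|W|\le n/2}\frac{|\partial W|}{d|W|}$, where $\partial W=\{\{i,j\}\in E: i\in W,\ j\in[n]\setminus W\}$. The graphical matrix tuple $\mathbf{B}_G$ is the tuple of the $2|E|=dn$ matrices $\sqrt n\,\mathrm{E}_{i,j}\in\mathrm{M}(n,\mathbb{C})$ indexed by ordered pairs $(i,j)$ with $\{i,j\}\in E$, where $\mathrm{E}_{i,j}$ has a $1$ in position $(i,j)$ and zeros elsewhere. Thus $\mathbf{B}_{K_2}=\left(\begin{bmatrix}0&\sqrt2\\0&0\end{bmatrix},\begin{bmatrix}0&0\\\sqrt2&0\end{bmatrix}\right)$. A tuple $\mathbf{B}=(B_1,\dots,B_m)\in\mathrm{M}(n,\mathbb{C})^m$ is doubly stochastic if $\sum_iB_iB_i^*=\sum_iB_i^*B_i=mI_n$ (this holds for $\mathbf{B}_G$). For such a tuple let $\Phi_{\mathbf{B}}(X)=\frac1m\sum_{i=1}^mB_iXB_i^*$. With $P_V$ the orthogonal projection onto $V$ and $\langle X,Y\rangle=\mathrm{Tr}(X^*Y)$, the quantum edge expansion is $$h_Q(\mathbf{B})=\min_{V\le\mathbb{C}^n,\ 1\le\dim V\le n/2}\frac{\langle I_n-P_V,\Phi_{\mathbf{B}}(P_V)\rangle}{\dim V}.$$ *)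

(* Defs.v *)
From HB Require Import structures.
From mathcomp Require Import all_boot all_order all_algebra.
From mathcomp Require Import boolp classical_sets reals.
From mathcomp Require Import complex.

Set Implicit Arguments.
Unset Strict Implicit.
Unset Printing Implicit Defensive.

Import Order.TTheory GRing.Theory Num.Theory.

Local Open Scope ring_scope.
Local Open Scope complex_scope.
Local Open Scope sesquilinear_scope.

Definition is_minimum (R : realType) (S : set R) (x : R) : Prop :=
  S x /\ lbound S x.

Lemma is_minimum_uniq (R : realType) (S : set R) (x y : R) :
  is_minimum S x -> is_minimum S y -> x = y.
Proof.
by case=> Sx lx [Sy ly]; apply/eqP; rewrite eq_le lx // ly.
Qed.

(* The edge {i, j} is [set i; j]; there are no loops since every edge has two
   elements. *)
Record regular_graph (d n : nat) := RegularGraph {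
  edges : {set {set 'I_n}};
  card_edge : forall e, e \in edges -> #|e| = 2%N;
  degreeE : forall i, #|[set j | [set i; j] \in edges]| = d
}.

Section EdgeExpansion.
Variables (R : realType) (d n : nat) (G : regular_graph d n).

Definition edge_boundary (W : {set 'I_n}) : {set {set 'I_n}} :=
  [set e in edges G | [exists i in W, exists j in ~: W, e == [set i; j]]].

Definition edge_ratio (W : {set 'I_n}) : R :=
  #|edge_boundary W|%:R / (d * #|W|)%:R.

(* [h] is h(G); at most one such [h] exists, by [is_minimum_uniq]. *)
Definition is_edge_expansion (h : R) : Prop :=
  is_minimum [set x | exists W : {set 'I_n},
    [/\ (1 <= #|W|)%N, (#|W|.*2 <= n)%N & x = edge_ratio W]]%classic h.

End EdgeExpansion.

Section OrthogonalProjection.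
Variables (R : realType) (n : nat).

Definition hs_inner (X Y : 'M[R[i]]_n) : R[i] := \tr (X^t* *m Y).

Definition basis_mx (V : {vspace 'cV[R[i]]_n}) : 'M[R[i]]_(\dim V, n) :=
  \matrix_(k < \dim V) ((vbasis V)`_k)^T.

(* [proj_ortho] acts on row vectors from the right; transposing gives the
   orthogonal projection acting on column vectors from the left. *)
Definition orthoproj (V : {vspace 'cV[R[i]]_n}) : 'M[R[i]]_n :=
  (proj_ortho (basis_mx V))^T.

Lemma basis_mxP (V : {vspace 'cV[R[i]]_n}) (v : 'cV[R[i]]_n) :
  (v^T <= basis_mx V)%MS = (v \in V).
Proof.
apply/submxP/idP => [[a va]|vV].
  rewrite -[v]trmxK va -[a *m _]trmxK trmxK mulmx_sum_row linear_sum /=.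
  apply: memv_suml => k _; rewrite rowK linearZ /= trmxK memvZ //.
  by apply: vbasis_mem; rewrite mem_nth // size_tuple.
exists (\row_k coord (vbasis V) k v).
rewrite [in LHS](coord_vbasis vV) linear_sum mulmx_sum_row.
by apply: eq_bigr => k _; rewrite rowK mxE linearZ.
Qed.

Implicit Types (V : {vspace 'cV[R[i]]_n}) (v : 'cV[R[i]]_n).

Lemma orthoproj_id V v : v \in V -> orthoproj V *m v = v.
Proof.
move=> vV; apply: trmx_inj; rewrite trmx_mul trmxK proj_ortho_id //.
by rewrite basis_mxP.
Qed.

Lemma orthoproj_mem V v : orthoproj V *m v \in V.
Proof. by rewrite -basis_mxP trmx_mul trmxK proj_ortho_sub. Qed.

Lemma orthoproj_idem V : orthoproj V *m orthoproj V = orthoproj V.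
Proof. by rewrite -trmx_mul proj_ortho_proj. Qed.

Lemma orthoproj_herm V : (orthoproj V)^t* = orthoproj V.
Proof.
rewrite /orthoproj trmxK; set Q := proj_ortho _.
have QQ : Q *m (1%:M - Q)^t* = 0.
  have := proj_ortho_compl_sub (basis_mx V) 1%:M.
  rewrite mul1mx -/Q => h1.
  apply/orthomx1P; rewrite orthomx_sym; apply: submx_trans h1 _.
  by rewrite submx_ortho; have := proj_ortho_sub (basis_mx V) 1%:M; rewrite mul1mx.
have QE : Q = Q *m Q^t*.
  apply/eqP; rewrite -subr_eq0; apply/eqP; rewrite -[RHS]QQ.
  rewrite linearB /= map_mxB trmx1 map_mx1 mulmxBr mulmx1 //.
have QH : Q = Q^t*.
  by rewrite [RHS](congr1 (fun X => X^t*) QE) trmx_mul map_mxM trmxCK.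
by rewrite {1}QH map_mxCK.
Qed.

End OrthogonalProjection.

Section QuantumEdgeExpansion.
Variables (R : realType) (m n : nat) (B : m.-tuple 'M[R[i]]_n).

Definition doubly_stochastic : Prop :=
  \sum_(k < m) tnth B k *m (tnth B k)^t* = m%:R%:M /\
  \sum_(k < m) (tnth B k)^t* *m tnth B k = m%:R%:M.

Definition Phi (X : 'M[R[i]]_n) : 'M[R[i]]_n :=
  m%:R^-1 *: \sum_(k < m) tnth B k *m X *m (tnth B k)^t*.

Definition quantum_edge_ratio (V : {vspace 'cV[R[i]]_n}) : R[i] :=
  hs_inner (1%:M - orthoproj V) (Phi (orthoproj V)) / (\dim V)%:R.

(* The ratio of every [V] is real (in the order of [R[i]], [0 <= z] entails
   that [z] is real), so no [V] is lost when [is_quantum_edge_expansion]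
   passes from [R[i]] to [R]. *)
Lemma quantum_edge_ratio_ge0 V : 0 <= quantum_edge_ratio V.
Proof.
rewrite /quantum_edge_ratio mulr_ge0 ?invr_ge0 ?ler0n //.
rewrite /hs_inner /Phi -scalemxAr mxtraceZ mulr_ge0 ?invr_ge0 ?ler0n //.
rewrite mulmx_sumr raddf_sum /=; apply: sumr_ge0 => k _.
set P := orthoproj V; set A := tnth B k; pose Q : 'M_n := 1%:M - P.
have QH : Q^t* = Q.
  by rewrite /Q linearB /= map_mxB trmx1 map_mx1 orthoproj_herm.
have QQ : Q *m Q = Q.
  by rewrite /Q mulmxBl mul1mx mulmxBr mulmx1 orthoproj_idem subrr subr0.
rewrite -/Q QH.
have -> : \tr (Q *m (A *m P *m A^t*)) = \tr ((Q *m A *m P) *m (Q *m A *m P)^t*).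
  rewrite !trmx_mul !map_mxM /= orthoproj_herm QH -/P.
  rewrite !mulmxA -(mulmxA _ P P) orthoproj_idem -/P.
  by rewrite [RHS]mxtrace_mulC !mulmxA QQ.
rewrite /mxtrace; apply: sumr_ge0 => i _; rewrite mxE; apply: sumr_ge0 => j _.
by rewrite !mxE mul_conjC_ge0.
Qed.

(* [h] is h_Q(B); at most one such [h] exists, by [is_minimum_uniq]. *)
Definition is_quantum_edge_expansion (h : R) : Prop :=
  is_minimum [set x | exists V : {vspace 'cV[R[i]]_n},
    [/\ (1 <= \dim V)%N, ((\dim V).*2 <= n)%N &
        x%:C = quantum_edge_ratio V]]%classic h.

End QuantumEdgeExpansion.

Section GraphicalMatrixTuple.
Variables (R : realType) (d n : nat) (G : regular_graph d n).

Definition arcs : {set 'I_n * 'I_n} := [set p | [set p.1; p.2] \in edges G].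

Lemma card_arcs : #|arcs| = (d * n)%N.
Proof.
rewrite -sum1_card (eq_bigl (fun p : 'I_n * 'I_n => true &&
  ([set p.1; p.2] \in edges G))) => [|p]; last by rewrite inE.
rewrite -(pair_big_dep xpredT (fun i j => [set i; j] \in edges G)
  (fun _ _ => 1%N)) /=.
rewrite (eq_bigr (fun=> d)) ?sum_nat_const ?card_ord 1?mulnC // => i _.
by rewrite -[RHS](degreeE G i) -sum1_card; apply: eq_bigl => j; rewrite inE.
Qed.

Definition graph_tuple : #|arcs|.-tuple 'M[R[i]]_n :=
  [tuple of [seq sqrtC n%:R *: delta_mx p.1 p.2 | p <- enum_tuple arcs]].

Lemma graph_tuple_sum (F : 'M[R[i]]_n -> 'M[R[i]]_n) :
  \sum_(k < #|arcs|) F (tnth graph_tuple k) =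
  \sum_i \sum_(j | [set i; j] \in edges G)
    F (sqrtC n%:R *: delta_mx i j).
Proof.
rewrite -(big_tuple _ _ graph_tuple xpredT F) /= big_map big_enum /=.
rewrite pair_big_dep /=; apply: eq_big => [p|p _]; first by rewrite inE.
by case: p.
Qed.

Lemma graph_tuple_doubly_stochastic : doubly_stochastic graph_tuple.
Proof.
pose s : R[i] := sqrtC n%:R.
have ss : s * s^* = n%:R.
  by rewrite geC0_conj ?sqrtC_ge0 ?ler0n // -expr2 sqrtCK.
have dE i j : (s *: delta_mx i j : 'M_n)^t* = s^* *: delta_mx j i.
  by rewrite linearZ /= map_mxZ trmx_delta map_delta_mx.
have sumE : \sum_i n%:R *: (delta_mx i i *+ d) = #|arcs|%:R%:M :> 'M[R[i]]_n.
  rewrite -scaler_sumr sumrMnl -mx1_sum_delta -[1%:M *+ d]scaler_nat scalerA -natrM.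
  by rewrite scale_scalar_mx mulr1 card_arcs mulnC.
have degE i : #|[pred j | [set i; j] \in edges G]| = d.
  by rewrite -[RHS](degreeE G i) cardsE.
split; rewrite -sumE.
  rewrite (graph_tuple_sum (fun X => X *m X^t*)); apply: eq_bigr => i _.
  rewrite (eq_bigr (fun=> n%:R *: delta_mx i i)) => [|j _].
    by rewrite sumr_const degE scalerMnr.
  by rewrite -/s dE -scalemxAl -scalemxAr mul_delta_mx scalerA ss.
rewrite (graph_tuple_sum (fun X => X^t* *m X)).
rewrite (exchange_big_dep xpredT) //=; apply: eq_bigr => j _.
rewrite (eq_bigr (fun=> n%:R *: delta_mx j j)) => [|i _].
  under eq_bigl do rewrite finset.setUC.
  by rewrite sumr_const degE scalerMnr.
by rewrite -/s dE -scalemxAl -scalemxAr mul_delta_mx scalerA mulrC ss.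
Qed.

End GraphicalMatrixTuple.

Fact K2_card (e : {set 'I_2}) : e \in [set [set: 'I_2]] -> #|e| = 2%N.
Proof. by rewrite inE => /eqP->; rewrite cardsT card_ord. Qed.

Fact K2_degree (i : 'I_2) :
  #|[set j | [set i; j] \in [set [set: 'I_2]]]| = 1%N.
Proof.
have -> : [set j | [set i; j] \in [set [set: 'I_2]]] = [set~ i].
  apply/setP => j; rewrite !inE eqEcard finset.subsetT cardsT card_ord cards2.
  by rewrite eq_sym; case: (j == i).
by rewrite cardsC1 card_ord.
Qed.

Definition K2 : regular_graph 1 2 := RegularGraph K2_card K2_degree.

(* Main.v *)
Require Import Defs.
From mathcomp Require Import all_boot all_order all_algebra.
From mathcomp Require Import reals.
From mathcomp Require Import complex zify ring lra.

(* In dimension 2 only lines V matter. The map attached to K_2 sends X to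
   diag(X_11, X_00), so, writing p = (P_V)_00 and using that P_V has trace 1,
   the ratio of a line V is p^2 + (1 - p)^2 >= 1/2, with equality on the line
   spanned by (1, 1). *)

Set Implicit Arguments.
Unset Strict Implicit.
Unset Printing Implicit Defensive.

Import Order.TTheory GRing.Theory Num.Theory.

Local Open Scope ring_scope.
Local Open Scope complex_scope.
Local Open Scope sesquilinear_scope.

Lemma edge_boundary_K2 (i : 'I_2) : edge_boundary K2 [set i] = edges K2.
Proof.
apply/setP => e; rewrite inE; case: (boolP (e \in edges K2)) => //=.
rewrite inE => /eqP->; apply/existsP; exists i; rewrite inE eqxx /=.
(* In ['I_2], [rev_ord] swaps the two vertices, so it supplies the endpoint outside the
   singleton. *)
have ni : rev_ord i != i by case: i => -[|[|]].
apply/existsP; exists (rev_ord i); rewrite !inE ni /=.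
by rewrite eq_sym eqEcard finset.subsetT cardsT card_ord cards2 eq_sym ni.
Qed.

(** The size bounds leave only singletons [W], and the one edge leaves each of them, so 1 is the
    only ratio. *)
Lemma edge_expansion_K2 (R : realType) : is_edge_expansion K2 (1 : R).
Proof.
have ratio1 i : edge_ratio R K2 [set i] = 1.
  by rewrite /edge_ratio edge_boundary_K2 !cards1 divr1.
split=> [|_ [W [W_gt0 W_le1 ->]]].
  by exists [set ord0]; rewrite cards1 ratio1.
have /cards1P[i ->] : #|W| == 1%N by lia.
by rewrite ratio1.
Qed.

Section OrthogonalProjectionTrace.
Variables (R : realType) (n : nat).
Implicit Type V : {vspace 'cV[R[i]]_n}.

Lemma basis_mx_free V : row_free (basis_mx V).
Proof.
apply/inj_row_free => u uV0; apply/rowP => k; rewrite mxE.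
have /freeP-> // := basis_free (vbasisP V).
apply: trmx_inj; rewrite trmx0 -[RHS]uV0 mulmx_sum_row linear_sum.
by apply: eq_bigr => j _; rewrite rowK linearZ.
Qed.

(** Factor the projection as [D *m A] through the basis matrix. It fixes the rows of [A], so
    [A *m D *m A = A]; cancelling the row-free [A] leaves [A *m D = 1%:M] of size [\dim V], and the
    trace is cyclic. *)
Lemma mxtrace_orthoproj V : \tr (orthoproj V) = (\dim V)%:R.
Proof.
rewrite mxtrace_tr; set A := basis_mx V.
have /submxP[D QE] : (proj_ortho A <= A)%MS.
  by rewrite -[proj_ortho A]mul1mx proj_ortho_sub.
have AD1 : A *m D = 1%:M.
  apply: (row_free_inj (basis_mx_free V)).
  by rewrite mul1mx -mulmxA -QE proj_ortho_id.
by rewrite QE mxtrace_mulC AD1 mxtrace1.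
Qed.

Lemma orthoproj_conj V i j : (orthoproj V i j)^* = orthoproj V j i.
Proof. by rewrite -[in RHS]orthoproj_herm !mxE. Qed.

End OrthogonalProjectionTrace.

(** Conjugating [X] by a matrix unit at [(i, j)] leaves only the entry [X j j], moved to position
    [(i, i)]; the factor [n%:R] is the squared scaling. *)
Lemma Phi_graph_tuple (R : realType) (d n : nat) (G : regular_graph d n)
    (X : 'M[R[i]]_n) :
  Phi (graph_tuple R G) X = (d * n)%:R^-1 *:
    \sum_i \sum_(j | [set i; j] \in edges G) (n%:R * X j j) *: delta_mx i i.
Proof.
rewrite /Phi {1}card_arcs; congr (_ *: _).
rewrite (graph_tuple_sum G (fun B => B *m X *m B^t*)).
apply: eq_bigr => i _; apply: eq_bigr => j _.
have ss : sqrtC n%:R * (sqrtC n%:R)^* = n%:R :> R[i].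
  by rewrite geC0_conj ?sqrtC_ge0 ?ler0n // -expr2 sqrtCK.
rewrite linearZ /= map_mxZ trmx_delta map_delta_mx.
rewrite -!scalemxAl -scalemxAr scalerA ss -scalerA; congr (_ *: _).
apply/matrixP => k l; rewrite !mxE (bigD1 j) //= big1 => [|q qj].
  rewrite !mxE eqxx addr0 (bigD1 j) //= big1 => [|q qj].
    rewrite !mxE eqxx addr0.
    by case: (k == i); case: (l == i); rewrite /= ?mul1r ?mulr1 ?mul0r ?mulr0.
  by rewrite !mxE (negPf qj) andbF mul0r.
by rewrite !mxE (negPf qj) mulr0.
Qed.

Lemma Phi_K2 (R : realType) (X : 'M[R[i]]_2) :
  Phi (graph_tuple R K2) X =
  X 1 1 *: delta_mx 0 0 + X 0 0 *: delta_mx 1 1.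
Proof.
have edgeE (i j : 'I_2) : ([set i; j] \in edges K2) = (i != j).
  by rewrite inE eqEcard finset.subsetT cardsT card_ord cards2; case: eqP.
have lift1 : lift ord0 ord0 = 1 :> 'I_2 by apply: val_inj.
have ord00 : ord0 = 0 :> 'I_2 by apply: val_inj.
rewrite Phi_graph_tuple !big_ord_recl big_ord0 /=.
do 2!rewrite big_mkcond !big_ord_recl big_ord0 /=.
rewrite !edgeE !lift1 !ord00 /= !addr0 add0r.
have two_neq0 : 2%:R != 0 :> R[i] by rewrite pnatr_eq0.
by rewrite mul1n scalerDr !scalerA !mulrA !mulVf // !mul1r.
Qed.

Lemma quantum_edge_ratio_K2 (R : realType) (V : {vspace 'cV[R[i]]_2}) :
  \dim V = 1%N ->
  quantum_edge_ratio (graph_tuple R K2) V =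
  orthoproj V 0 0 ^+ 2 + (1 - orthoproj V 0 0) ^+ 2.
Proof.
move=> dimV; rewrite /quantum_edge_ratio dimV divr1 /hs_inner Phi_K2.
have lift1 : lift ord0 ord0 = 1 :> 'I_2 by apply: val_inj.
have ord00 : ord0 = 0 :> 'I_2 by apply: val_inj.
have trP : orthoproj V 1 1 = 1 - orthoproj V 0 0.
  have := mxtrace_orthoproj V.
  rewrite dimV mulr1n /mxtrace !big_ord_recl big_ord0 addr0 lift1 ord00 => <-.
  by rewrite addrC addrK.
have -> : (1%:M - orthoproj V)^t* = 1%:M - orthoproj V.
  by rewrite linearB /= map_mxB trmx1 map_mx1 orthoproj_herm.
(* Only the diagonal of the projection enters the trace, so [trP] is all that has to be kept. *)
move: (orthoproj V) trP => P trP.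
rewrite /mxtrace !big_ord_recl big_ord0 !mxE !big_ord_recl !big_ord0 !mxE.
by rewrite lift1 ord00 /= trP; ring.
Qed.

(** No explicit projection matrix is computed. Fixing [v] makes row 0 sum to 1; mapping into the
    line makes column 0 constant; being Hermitian then gives [P 0 1 = P 0 0], so twice this entry is
    1. *)
Lemma orthoproj_diagonal_line (R : realType) :
  orthoproj <[const_mx 1 : 'cV[R[i]]_2]>%VS 0 0 = 1 / 2.
Proof.
set v : 'cV_2 := const_mx 1.
have lift1 : lift ord0 ord0 = 1 :> 'I_2 by apply: val_inj.
have ord00 : ord0 = 0 :> 'I_2 by apply: val_inj.
have Pv := orthoproj_id (memv_line v).
have /vlineP[c Pe] := orthoproj_mem <[v]>%VS (delta_mx 0 0).
have P01 := orthoproj_conj <[v]>%VS 1 0.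
have P00 := orthoproj_conj <[v]>%VS 0 0.
move: (orthoproj _) Pv Pe P01 P00 => P /matrixP Pv /matrixP Pe P01 P00.
have row0 : P 0 0 + P 0 1 = 1.
  have := Pv 0 0.
  by rewrite !mxE !big_ord_recl big_ord0 !mxE lift1 ord00 !mulr1 addr0.
have col0 i : P i 0 = c by have := Pe i 0; rewrite -colE !mxE mulr1.
have {}P01 : P 0 1 = P 0 0 by rewrite -P01 -[RHS]P00 !col0.
apply: (canRL (mulfK _)); first by rewrite pnatr_eq0.
by rewrite mulr_natr mulr2n -{2}P01.
Qed.

Lemma half_le_sum_sqr (F : realFieldType) (p : F) :
  1 / 2 <= p ^+ 2 + (1 - p) ^+ 2.
(* The two sides differ by [2 * (p - 1 / 2) ^+ 2]. *)
Proof. by have := sqr_ge0 (p - 1 / 2); nra. Qed.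

Lemma quantum_edge_expansion_K2 (R : realType) :
  is_quantum_edge_expansion (graph_tuple R K2) (1 / 2).
Proof.
split=> [|x [V [V_gt0 V_le1 xE]]].
  have dim1 : \dim <[const_mx 1 : 'cV[R[i]]_2]> = 1%N.
    rewrite dim_vline; suff -> : const_mx 1 != 0 :> 'cV[R[i]]_2 by [].
    by apply/eqP => /matrixP/(_ 0 0)/eqP; rewrite !mxE oner_eq0.
  exists <[const_mx 1]>%VS; rewrite dim1; split=> //.
  rewrite quantum_edge_ratio_K2 // orthoproj_diagonal_line.
  by rewrite rmorphM /= fmorphV rmorph_nat rmorph1; field.
have dimV : \dim V = 1%N by lia.
move: xE; rewrite quantum_edge_ratio_K2 //.
(* A diagonal entry of a Hermitian matrix is real, which moves the inequality from [R[i]] to [R]. *)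
have /CrealP/complex_realP[p ->] := orthoproj_conj V 0 0.
rewrite -(rmorph1 (real_complex R)) -rmorphB -!rmorphXn -rmorphD /=.
by move=> /complexI->; exact: half_le_sum_sqr.
Qed.

Theorem proposition1p14 (R : realType) :
  is_edge_expansion K2 (1 : R) /\
  exists2 h : R, is_quantum_edge_expansion (graph_tuple R K2) h & h <= 1 / 2.
Proof.
split; first exact: edge_expansion_K2.
(* The minimum is exactly 1/2, so the bound holds with equality. *)
by exists (1 / 2); [exact: quantum_edge_expansion_K2 | exact: lexx].
Qed.
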